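(* Let $K\subset\mathbb{R}$ be a bounded measurable set with positive Lebesgue measure, and let $\Lambda\subset\mathbb{R}^2$ be a rational lattice with $\mathrm{dens}(\Lambda)=1$. If $\mathcal{G}(|K|^{-1/2}\chi_K,\Lambda)$ is a Gabor orthonormal basis for $L^2(\mathbb{R})$, then $K$ tiles $\mathbb{R}$ by translations and is a spectral set.
   Context: A rational lattice in $\mathbb{R}^2$ is a set $\Lambda=M(\mathbb{Z}^2)$ with $M$ an invertible $2\times2$ matrix with rational entries; $\mathrm{dens}(\Lambda)=|\det M|^{-1}$. $|K|$ denotes Lebesgue measure and $\chi_K$ the indicator function of $K$. For $g\in L^2(\mathbb{R})$ and a countable set $\Lambda\subset\mathbb{R}^{2}$, the Gabor system $\mathcal{G}(g,\Lambda)$ is the collection of functions $\pi(a,b)g(x)=e^{2\pi i bx}g(x-a)$, $(a,b)\in\Lambda$; it is a Gabor orthonormal basis if it is an orthonormal basis of $L^2(\mathbb{R})$. A set $K$ of positive finite measure is spectral if there is a countable set $\Gamma\subset\mathbb{R}$ such that $\{e^{2\pi i\gamma x}:\gamma\in\Gamma\}$ is an orthogonal basis of $L^2(K)$. $K$ tiles $\mathbb{R}$ by translations if there is a countable set $\mathcal{J}\subset\mathbb{R}$ with $\sum_{t\in\mathcal{J}}\chi_K(x+t)=1$ for a.e. $x\in\mathbb{R}$. *)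

(* Defs.v *)
From HB Require Import structures.
From mathcomp Require Import all_boot all_order all_algebra.
From mathcomp Require Import all_classical all_reals all_analysis.
From mathcomp.real_closed Require Import complex.

Set Implicit Arguments.
Unset Strict Implicit.
Unset Printing Implicit Defensive.

Import Order.TTheory GRing.Theory Num.Theory.
Local Open Scope classical_set_scope.
Local Open Scope ring_scope.
Local Open Scope complex_scope.

(* The library's [lebesgue_measure] lives on the Borel sets; sets and functions
   are here only required to be Lebesgue measurable, so we work on R with the
   Lebesgue (= Caratheodory) sigma-algebra. The carrier is R itself. *)
Definition lebesgueType (R : realType) : measurableType _ :=
  caratheodory_type (@mu_ext _ (ocitv_type R) R (wlength idfun)).

Definition leb (R : realType) : {measure set (lebesgueType R) -> \bar R} :=
  @completed_lebesgue_measure R.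

(* L^2(D, mu; C) on representatives: elements are functions, and equality is
   never tested except through the seminorm [L2norm]. *)
Section complex_L2.
Context {d : measure_display} {T : measurableType d} {R : realType}.
Variables (mu : {measure set T -> \bar R}) (D : set T).

Definition L2 (f : T -> R[i]) : Prop :=
  [/\ measurable_fun D (fun x => complex.Re (f x)),
      measurable_fun D (fun x => complex.Im (f x)) &
      mu.-integrable D (fun x => (complex.Re (f x) ^+ 2 + complex.Im (f x) ^+ 2)%:E)].

Definition cintegral (f : T -> R[i]) : R[i] :=
  (Rintegral mu D (fun x => complex.Re (f x))) +i* (Rintegral mu D (fun x => complex.Im (f x))).

Definition inner (f g : T -> R[i]) : R[i] :=
  cintegral (fun x => f x * (g x)^*%C).

Definition L2norm (f : T -> R[i]) : R := Num.sqrt (complex.Re (inner f f)).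

Context {I : choiceType}.

(* The family (e i), i in A, where A is a subset of the index type I. *)
Definition orthogonal_basis (A : set I) (e : I -> T -> R[i]) : Prop :=
  [/\ forall i, A i -> L2 (e i) /\ L2norm (e i) != 0,
      forall i j, A i -> A j -> i <> j -> inner (e i) (e j) = 0 &
      forall (f : T -> R[i]) (eps : R), L2 f -> 0 < eps ->
        exists (s : seq I) (c : I -> R[i]), (forall i, i \in s -> A i) /\
          L2norm (fun x => f x - \sum_(i <- s) c i * e i x) < eps].

Definition orthonormal_basis (A : set I) (e : I -> T -> R[i]) : Prop :=
  orthogonal_basis A e /\ forall i, A i -> L2norm (e i) = 1.

End complex_L2.

Section gabor.
Context {R : realType}.

Definition expi (t : R) : R[i] := cos t +i* sin t.

(* Points of R^2 are column vectors (a, b)^T. *)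
Definition tf_shift (p : 'cV[R]_2) (g : R -> R[i]) : R -> R[i] :=
  let a := p ord0 ord0 in let b := p ord_max ord0 in
  fun x => expi (2 * pi * b * x) * g (x - a).

Definition gabor_orthonormal_basis (g : R -> R[i]) (L : set 'cV[R]_2) : Prop :=
  orthonormal_basis (leb R) setT L (fun p => tf_shift p g).

Definition spectral (K : set R) : Prop :=
  [/\ measurable (K : set (lebesgueType R)), (0 < leb R K < +oo)%E &
      exists G : set R, countable G /\
        orthogonal_basis (leb R) K G (fun gamma x => expi (2 * pi * gamma * x))].

Definition tiles (K : set R) : Prop :=
  exists J : set R, countable J /\
    {ae leb R, forall x : R, (\esum_(t in J) (\1_K (x + t) : R)%:E = 1)%E}.

Definition normalized_indicator (K : set R) (x : R) : R[i] :=
  ((Num.sqrt (fine (leb R K)))^-1 * \1_K x)%:C.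

End gabor.

Definition rational_lattice (R : realType) (M : 'M[rat]_2) : set 'cV[R]_2 :=
  [set map_mx ratr (M *m map_mx intr z) | z in [set: 'cV[int]_2]].

Definition lattice_dens (M : 'M[rat]_2) : rat := `|\det M|^-1.

(* Main.v *)
Require Import Defs.
From mathcomp Require Import all_boot all_order all_algebra.
From mathcomp Require Import all_classical all_reals all_analysis.
From mathcomp.real_closed Require Import complex.
From mathcomp Require Import measurable_realfun zify ring lra.

Set Implicit Arguments.
Unset Strict Implicit.
Unset Printing Implicit Defensive.

Import Order.TTheory GRing.Theory Num.Theory.
Import numFieldNormedType.Exports.
Local Open Scope classical_set_scope.
Local Open Scope ring_scope.

(** By Bezout the lattice has a lower triangular basis: it consists of the points
    (a m, d m + n / a) with m, n in Z, for some a > 0.  The Gabor functions are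
    then exponentials times the indicator functions of the sets K + a m.

    These sets are pairwise disjoint up to null sets.  Indeed K is bounded, so by
    descending induction on m > 0 one may assume that K + a j meets K in a null
    set for all j > m.  Let F be the intersection of K and K + a m; then the
    translates F + a j are pairwise disjoint up to null sets.  Orthogonality of
    the functions of index m to that of index 0 says that all Fourier
    coefficients of the periodization of e^(2 i pi d m x) 1_F vanish.  The terms
    of this periodization do not overlap, so F is null.

    The sets K + a m cover the line because the Gabor functions vanish outside
    their union, while they span a dense subspace.  Hence K tiles by a Z.
    Finally the functions e^(2 i pi n x / a) form an orthogonal basis of L^2(K):
    on K, an approximation by Gabor functions only involves those with m = 0. *)

(** * Lebesgue measure on the Caratheodory sigma-algebra *)

Definition translate (R : realType) (A : set R) (t : R) : set R :=
  [set x | A (x - t)].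

Section leb_facts.
Context {R : realType}.
Implicit Types (A B : set R) (t : R).

(** As a function on sets, [leb] is the outer measure generated by interval lengths, so monotonicity
    and subadditivity hold for arbitrary sets. *)
Lemma le_leb A B : A `<=` B -> (leb R A <= leb R B)%E.
Proof. exact: (@le_outer_measure _ _ (mu_ext (@wlength R idfun))). Qed.

Lemma lebU_le A B : (leb R (A `|` B) <= leb R A + leb R B)%E.
Proof. exact: (@outer_measureU2 _ _ (mu_ext (@wlength R idfun))). Qed.

Lemma leb_null_sub A B : A `<=` B -> leb R B = 0%E -> leb R A = 0%E.
Proof.
by move=> AB B0; apply/eqP; rewrite eq_le measure_ge0 andbT -B0 le_leb.
Qed.

Lemma leb_oc (a b : R) : a <= b -> leb R `]a, b]%classic = (b - a)%:E.
Proof.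
move=> ab; rewrite [LHS](_ : _ = lebesgue_measure `]a, b]%classic)//.
rewrite lebesgue_measure_itv/= lte_fin.
by case: ltP => // ba; rewrite (_ : a = b) ?subrr//; apply/eqP; rewrite eq_le ab.
Qed.

Lemma leb_oo (a b : R) : a <= b -> leb R `]a, b[%classic = (b - a)%:E.
Proof.
move=> ab; rewrite [LHS](_ : _ = lebesgue_measure `]a, b[%classic)//.
rewrite lebesgue_measure_itv/= lte_fin.
by case: ltP => // ba; rewrite (_ : a = b) ?subrr//; apply/eqP; rewrite eq_le ab.
Qed.

Lemma bounded_set_normr A : bounded_set A ->
  exists2 M : R, 0 < M & forall x, A x -> `|x| <= M.
Proof.
move=> [M [_ /(_ (`|M| + 1))]].
have -> : M < `|M| + 1 by rewrite (le_lt_trans (ler_norm _))// ltrDl.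
by move=> /(_ isT) AM; exists (`|M| + 1); [rewrite ltr_wpDl | exact: AM].
Qed.

Lemma leb_bounded A : bounded_set A -> (leb R A < +oo)%E.
Proof.
move=> /bounded_set_normr[M M0 AM].
have /le_leb/le_lt_trans : A `<=` `](- (M + 1)), (M + 1)[%classic.
  by move=> x /AM; rewrite ler_norml /= in_itv /= => /andP[? ?]; apply/andP; split; lra.
by apply; rewrite leb_oo ?ltry//; lra.
Qed.

(** Shifting a cover of [A] by half-open intervals gives a cover of the translate with the same
    total length. *)
Let leb_translate_le A t : (leb R (translate A t) <= leb R A)%E.
Proof.
apply: le_ereal_inf_tmp => _ [F [mF AF] <-].
apply: ereal_inf_lbound; exists (fun k => translate (F k) t); first split.
- move=> k; have /ocitvP [F0|[[a b] /= ab Fab]] := mF k.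
    by rewrite F0; apply/ocitvP; left.
  apply/ocitvP; right; exists (a + t, b + t) => /=; first by rewrite ltrD2r.
  rewrite Fab; apply/seteqP; split=> x /=; rewrite /translate/= !in_itv/= => /andP[? ?].
    by apply/andP; split; lra.
  by apply/andP; split; lra.
- by move=> x /= /AF [k _ Fk]; exists k.
- apply: eq_eseriesr => k _.
  have /ocitvP [F0|[[a b] /= ab Fab]] := mF k.
    by rewrite F0; congr (wlength _ _); apply/seteqP; split.
  rewrite Fab (_ : translate _ _ = `]a + t, b + t]%classic); last first.
    apply/seteqP; split=> x /=; rewrite /translate/= !in_itv/= => /andP[? ?].
      by apply/andP; split; lra.
    by apply/andP; split; lra.
  by rewrite !wlength_itv_bnd//= ?lerD2r ?ltW// /idfun/=; congr EFin; lra.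
Qed.

Lemma translateK A t : translate (translate A t) (- t) = A.
Proof. by apply/seteqP; split => x; rewrite /translate/= opprK addrK. Qed.

Lemma leb_translate A t : leb R (translate A t) = leb R A.
Proof.
apply/eqP; rewrite eq_le leb_translate_le/=.
by rewrite -{1}(translateK A t) leb_translate_le.
Qed.

Lemma borel_lebesgue A : measurable A -> measurable (A : set (lebesgueType R)).
Proof. by move=> mA; exact: sub_caratheodory. Qed.

Lemma itv_measurable (i : interval R) :
  measurable ([set` i] : set (lebesgueType R)).
Proof. apply: borel_lebesgue; exact: measurable_itv. Qed.

(** Measurability is the Caratheodory splitting criterion: testing the translate against [X] amounts
    to testing [A] against [X] shifted back. *)
Lemma translate_measurable A t : measurable (A : set (lebesgueType R)) ->
  measurable (translate A t : set (lebesgueType R)).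
Proof.
move=> mA.
have AE X : leb R X = (leb R (X `&` A) + leb R (X `&` ~` A))%E := mA X.
suff tE X : leb R X =
    (leb R (X `&` translate A t) + leb R (X `&` ~` translate A t))%E by exact: tE.
transitivity (leb R (translate X (- t))); first by rewrite leb_translate.
by rewrite [LHS]AE; congr (_ + _)%E;
  rewrite -[LHS](leb_translate _ t); congr (leb R _);
  apply/seteqP; split => x /=; rewrite /translate/= opprK subrK.
Qed.

Lemma borel_fun_lebesgue (D : set (lebesgueType R)) (f : R -> R) :
  measurable_fun setT f -> measurable D ->
  measurable_fun D (f : lebesgueType R -> R).
Proof.
move=> mf mD _ Y mY; apply: measurableI => //; apply: borel_lebesgue.
by rewrite -(setTI (f @^-1` Y)); apply: mf.
Qed.

Lemma leb_bigcup0 (F : nat -> set R) : (forall k, leb R (F k) = 0%E) ->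
  leb R (\bigcup_k F k) = 0%E.
Proof.
move=> F0; apply/eqP; rewrite eq_le measure_ge0 andbT.
apply: (le_trans (outer_measure_sigma_subadditive (mu_ext (@wlength R idfun)) F)).
rewrite (eseries0 (fun i _ _ => F0 i)); exact: lexx.
Qed.

Lemma leb_cover A (e : R) : (leb R A < +oo)%E -> 0 < e ->
  exists F : nat -> set R, [/\
    forall k, exists2 ab : R * R, ab.1 <= ab.2 & F k = `]ab.1, ab.2]%classic,
    A `<=` \bigcup_k F k & (\sum_(k <oo) leb R (F k) < leb R A + e%:E)%E].
Proof.
move=> Afin e0.
have Af : leb R A \is a fin_num by rewrite ge0_fin_numE.
have /(lb_ereal_inf_adherent e0) [_ [F [mF AF] <-] h] := Af.
exists F; split => //.
  move=> k; have /ocitvP [F0|[[a b] /= ab Fab]] := mF k.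
    (* An empty member of the cover is written as []0, 0]], so that every member is an interval. *)
    by exists (0, 0) => //=; rewrite F0 set_itvE.
  by exists (a, b) => //=; exact: ltW.
apply: le_lt_trans h; apply: lee_nneseries => [//|k _].
by rewrite -(measurable_mu_extE (wlength idfun)) //.
Qed.
End leb_facts.

(** * Intervals almost filled by a set of positive measure *)

Section density.
Context {R : realType}.
Implicit Types (A B : set R).

Lemma leb_bigcup_count0 (T : countType) (F : T -> set R) :
  (forall k, leb R (F k) = 0%E) -> leb R (\bigcup_k F k) = 0%E.
Proof.
move=> F0; pose G n := if unpickle n is Some t then F t else set0.
have G0 n : leb R (G n) = 0%E by rewrite /G; case: unpickle.
apply: leb_null_sub (leb_bigcup0 G0) => x [t _ Ftx].
by exists (pickle t) => //; rewrite /G pickleK.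
Qed.

(** A weak form of Lebesgue's density theorem: in a nearly optimal cover of a set of finite positive
    measure, some interval must be almost full. *)
Lemma leb_dense_interval A (eta r0 : R) : measurable (A : set (lebesgueType R)) ->
  leb R A != 0%E -> 0 < eta <= 1 / 2 -> 0 < r0 ->
  exists x0 r : R, [/\ 0 < r, r < r0 &
    (leb R (`](x0 - r)%R, (x0 + r)%R]%classic `\` A) <= (eta * (2 * r))%:E)%E].
Proof.
move=> mA A0 /andP[eta0 eta2] r00.
have h0 : 0 < r0 / 2 by rewrite divr_gt0.
set h := r0 / 2 in h0.
pose I (z : int) : set R := `]z%:~R * h, (z%:~R + 1) * h]%classic.
(* Cutting [A] down to one cell of a grid of step [r0 / 2] makes its measure finite and will bound
   the length of the interval found. *)
have [z Az] : exists z : int, leb R (A `&` I z) != 0%E.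
  apply: contrapT => /forallNP noz; move/eqP: A0; apply.
  apply: (@leb_null_sub _ _ (\bigcup_z (A `&` I z))); last first.
    by apply: leb_bigcup_count0 => z; apply/eqP/negP => /negP /noz.
  move=> x Ax; exists (Num.ceil (x / h) - 1) => //; split => //=.
  rewrite /I/= in_itv/= -ltr_pdivlMr// -ler_pdivrMr// intrB subrK; apply/andP; split.
    by have := ceilB1_lt (x / h); rewrite intrB.
  exact: ceil_ge.
have mI : measurable (I z : set (lebesgueType R)) by exact: itv_measurable.
have mAI : measurable (A `&` I z : set (lebesgueType R)) by exact: measurableI.
set A' := A `&` I z in Az mAI.
have A'h : (leb R A' <= h%:E)%E.
  apply: le_trans (_ : leb R (I z) <= _)%E; first by apply: le_leb => x [].
  by rewrite leb_oc ?lee_fin; [lra | rewrite ler_pM2r//; lra].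
have A'f : (leb R A' < +oo)%E by apply: le_lt_trans A'h _; rewrite ltry.
have A'gt : (0 < leb R A')%E by rewrite lt0e Az measure_ge0.
move A'E : (leb R A') => m; rewrite A'E in A'h A'f A'gt.
case: m => [m| |] // in A'E A'h A'f A'gt *.
rewrite lte_fin in A'gt; rewrite lee_fin in A'h.
have em : 0 < eta * m by rewrite mulr_gt0.
have [F [Fitv AF sF]] := leb_cover (A := A') (e := eta * m) ltac:(by rewrite A'E) em.
rewrite A'E in sF.
(* Otherwise summing over the cover gives [m <= (1 - eta) (1 + eta) m < m]. *)
have [k] : exists k, ((1 - eta)%:E * leb R (F k) < leb R (A' `&` F k))%E.
  apply: contrapT => /forallNP nok.
  have : (leb R A' <= \sum_(k <oo) leb R (A' `&` F k))%E.
    apply: le_trans (outer_measure_sigma_subadditive (mu_ext (@wlength R idfun)) _).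
    by apply: le_leb; rewrite -setI_bigcupr => x A'x; split => //; exact: AF.
  have : (\sum_(k <oo) leb R (A' `&` F k) <= \sum_(k <oo) (1 - eta)%:E * leb R (F k))%E.
    by apply: lee_nneseries => // k _; rewrite leNgt; apply/negP/nok.
  rewrite nneseriesZl => [h1 h2|]; last by move=> *.
  have := le_trans h2 h1; rewrite A'E; apply/negP; rewrite -ltNge.
  apply: le_lt_trans (_ : ((1 - eta)%:E * (m%:E + (eta * m)%:E) < _))%E.
    by apply: lee_wpmul2l; [rewrite lee_fin; lra | exact: ltW].
  by rewrite -EFinD -EFinM lte_fin; nra.
have [[a b]/= ab Fk] := Fitv k.
rewrite Fk leb_oc// => lt1.
have lt2 : (1 - eta) * (b - a) < m.
  rewrite -lte_fin EFinM; apply: lt_le_trans lt1 _; rewrite -A'E.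
  by apply: le_leb => x [].
have ltab : a < b.
  rewrite lt_neqAle ab andbT; apply/eqP => eab; subst b; move: lt1.
  rewrite subrr mule0 ltNge => /negP; apply.
  by rewrite set_itvE setI0 measure0.
(* As [eta <= 1 / 2], the half-length is less than [m], which is at most [h = r0 / 2]. *)
have half : (b - a) / 2 <= (1 - eta) * (b - a).
  by rewrite mulrC; apply: ler_wpM2r; lra.
exists ((a + b) / 2), ((b - a) / 2); split; [lra | rewrite /h in A'h; lra |].
rewrite (_ : _ - _ = a); last lra. rewrite (_ : _ + (b - a) / 2 = b); last lra.
have mJ : measurable (`]a, b]%classic : set (lebesgueType R)) by exact: itv_measurable.
apply: le_trans (_ : leb R (`]a, b]%classic `\` A') <= _)%E.
  by apply: le_leb => x [? nA]; split => // -[].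
rewrite measureD//=; last by rewrite leb_oc// ltry.
rewrite leb_oc// setIC.
have fJ : leb R (A' `&` `]a, b]%classic) \is a fin_num.
  by rewrite ge0_fin_numE//; apply: le_lt_trans (_ : _ <= leb R A')%E _;
    [apply: le_leb => x [] | rewrite A'E ltry].
move: lt1; rewrite -(fineK fJ) -EFinM -EFinB lte_fin lee_fin => lt1.
lra.
Qed.
End density.

(** * Polynomials and trigonometric polynomials *)

Section peaked_polynomial.
Context {R : realFieldType}.
Implicit Types (x v : R) (k m n : nat).

Lemma bernoulli_ge x m : 0 <= x <= 1 -> 1 - m%:R * x <= (1 - x) ^+ m.
Proof.
move=> /andP[x0 x1]; elim: m => [|m IH]; first by rewrite mul0r subr0 expr0.
rewrite exprS; apply: le_trans (_ : (1 - x) * (1 - m%:R * x) <= _).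
  by rewrite -natr1; have := ler0n R m; nra.
by apply: ler_wpM2l => //; lra.
Qed.

(** Division-free form of [(1 - x)^m <= 1 / (1 + m x)]; the induction rests on
    [(1 - x) (1 + (m + 1) x) <= 1 + m x]. *)
Lemma bernoulli_le x m : 0 <= x <= 1 -> (1 - x) ^+ m * (1 + m%:R * x) <= 1.
Proof.
move=> /andP[x0 x1]; elim: m => [|m IH]; first by rewrite mul0r addr0 expr0 mulr1.
apply: le_trans IH; rewrite exprSr -mulrA; apply: ler_wpM2l.
  by rewrite exprn_ge0//; lra.
by rewrite -natr1; have := ler0n R m; nra.
Qed.

(* The polynomials of Brosowski and Deutsch: on [0, 1] they approach the
   indicator function of [0, 1/k[ as n grows. *)
Definition peak k n : {poly R} := (1 - 'X^n) ^+ (k ^ n).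

Lemma peak_hornerE k n v : (peak k n).[v] = (1 - v ^+ n) ^+ (k ^ n).
Proof. by rewrite /peak horner_exp !hornerE. Qed.

Lemma peak01 k n v : 0 <= v <= 1 -> 0 <= (peak k n).[v] <= 1.
Proof.
move=> /andP[v0 v1]; rewrite peak_hornerE.
have w0 : 0 <= v ^+ n by rewrite exprn_ge0.
have w1 : v ^+ n <= 1 by rewrite exprn_ile1.
by apply/andP; split; [rewrite exprn_ge0 | rewrite exprn_ile1]; lra.
Qed.

(** Bernoulli's inequality bounds the value below by [1 - (k v)^n]. *)
Lemma peak_ge k n v : 0 <= v <= 1 -> k%:R * v <= 1 / 2 ->
  1 - (1 / 2) ^+ n <= (peak k n).[v].
Proof.
move=> /andP[v0 v1] kv; rewrite peak_hornerE.
apply: le_trans (bernoulli_ge _ _); last by rewrite exprn_ge0//= exprn_ile1.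
rewrite natrX -exprMn; apply: lerB => //; apply: lerXn2r => //.
- by rewrite nnegrE mulr_ge0.
- by rewrite nnegrE; lra.
Qed.

(** By [bernoulli_le] the value is at most [1 / (1 + (k v)^n)], and [(k v)^n >= 2^n]. *)
Lemma peak_le k n v : 0 <= v <= 1 -> 2 <= k%:R * v ->
  (peak k n).[v] <= (1 / 2) ^+ n.
Proof.
move=> /andP[v0 v1] kv; rewrite peak_hornerE.
have := @bernoulli_le (v ^+ n) (k ^ n).
rewrite exprn_ge0//= exprn_ile1// => /(_ isT); rewrite natrX -exprMn => h.
have p2 : 2 ^+ n <= (k%:R * v) ^+ n by apply: lerXn2r => //; rewrite nnegrE; lra.
have h0 : 0 <= (1 - v ^+ n) ^+ (k ^ n).
  by rewrite exprn_ge0// subr_ge0 exprn_ile1.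
rewrite div1r exprVn -div1r ler_pdivlMr ?exprn_gt0//.
apply: le_trans h; apply: ler_wpM2l => //; lra.
Qed.
End peaked_polynomial.

(** * Elementary bounds for sine and cosine *)

Section sine_bounds.
Context {R : realType}.
Implicit Types x y : R.

Let sin_le_id x : 0 <= x -> sin x <= x /\ - x <= sin x.
Proof.
move=> x0; have [c _] := @MVT_segment R sin cos 0 x x0 (fun y _ => is_derive_sin y)
  (continuous_subspaceT (@continuous_sin R)).
rewrite sin0 !subr0 => ->; have := cos_le1 c; have := cos_geN1 c; split; nra.
Qed.

Lemma normr_sin_le x : `|sin x| <= `|x|.
Proof.
have [x0|x0] := leP 0 x.
  have [h1 h2] := sin_le_id x0; rewrite ler_norml (ger0_norm x0); apply/andP; split; lra.
have nx0 : 0 <= - x by lra.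
have [h1 h2] := sin_le_id nx0; rewrite sinN in h1 h2.
rewrite ler_norml (ltr0_norm x0); apply/andP; split; lra.
Qed.

Lemma cos_half x : cos x = 1 - 2 * sin (x / 2) ^+ 2.
Proof.
rewrite {1}(_ : x = (x / 2) *+ 2); last by rewrite mulr2n; lra.
by rewrite cos_mulr2n cos2sin2 mulr2n; lra.
Qed.

Lemma cos_ge_quadratic x : 1 - x ^+ 2 / 2 <= cos x.
Proof.
have : sin (x / 2) ^+ 2 <= (x / 2) ^+ 2.
  by rewrite -(real_normK (num_real (sin _))) -(real_normK (num_real (x / 2)));
    apply: lerXn2r (normr_sin_le _); rewrite nnegrE.
by rewrite cos_half !expr2; lra.
Qed.

(** Write [sin x = 2 sin (x / 2) cos (x / 2)] and apply the mean value theorem to [sin (x / 2)].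
    Both cosines are at least [1 / 2] because [x / 2 <= pi / 4 < 1]. *)
Lemma sin_ge_quarter x : 0 <= x <= pi / 2 -> x / 4 <= sin x.
Proof.
move=> /andP[x0 xpi].
have y0 : 0 <= x / 2 by lra.
have pi4 : pi < 4 :> R by have := pihalf_lt2 R; lra.
have half (c : R) : 0 <= c <= 1 -> 1 / 2 <= cos c.
  by move=> ?; have := cos_ge_quadratic c; nra.
have [c cI] := @MVT_segment R sin cos 0 (x / 2) y0 (fun y _ => is_derive_sin y)
  (continuous_subspaceT (@continuous_sin R)).
rewrite sin0 !subr0 => sE.
have /half hc : 0 <= c <= 1.
  by move: cI; rewrite in_itv/= => /andP[? ?]; apply/andP; split; lra.
have /half hx : 0 <= x / 2 <= 1 by apply/andP; split; lra.
have -> : sin x = 2 * (sin (x / 2) * cos (x / 2)).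
  rewrite {1}(_ : x = (x / 2) *+ 2); last by rewrite mulr2n; lra.
  by rewrite sin_mulr2n mulr2n; lra.
rewrite sE.
have : (1 / 2) * (x / 2) <= cos c * (x / 2) by apply: ler_wpM2r.
nra.
Qed.

Lemma sin_sqr_ge x : `|x| <= pi / 2 -> (x / 4) ^+ 2 <= sin x ^+ 2.
Proof.
move=> xpi; have /sin_ge_quarter h : 0 <= `|x| <= pi / 2 by rewrite normr_ge0.
have -> : sin x ^+ 2 = sin `|x| ^+ 2.
  by have [x0|x0] := leP 0 x; [rewrite ger0_norm | rewrite ltr0_norm// sinN sqrrN].
have -> : (x / 4) ^+ 2 = (`|x| / 4) ^+ 2.
  by rewrite !exprMn real_normK// num_real.
have h0 : 0 <= `|x| / 4 by rewrite divr_ge0.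
have s0 := le_trans h0 h; exact: lerXn2r.
Qed.

Lemma sin_sqr_le x : sin x ^+ 2 <= x ^+ 2.
Proof.
by rewrite -(real_normK (num_real (sin _))) -(real_normK (num_real x));
  apply: lerXn2r (normr_sin_le _); rewrite nnegrE.
Qed.

Lemma sin_sqr_periodic x (j : int) : sin (x + pi * j%:~R) ^+ 2 = sin x ^+ 2.
Proof.
have step y : sin (y + pi) ^+ 2 = sin y ^+ 2 by rewrite sinDpi sqrrN.
elim/int_rec: j => [|n IH|n IH]; first by rewrite mulr0 addr0.
  by rewrite -IH -[RHS]step; congr (sin _ ^+ _); rewrite -addn1 PoszD intrD; ring.
by rewrite -IH -[LHS]step; congr (sin _ ^+ _); rewrite -addn1 PoszD opprD intrD; ring.
Qed.
End sine_bounds.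

(** * Orthogonality to polynomials in a squared sine *)

Section fourier_uniqueness.
Context {R : realType}.

Lemma lebesgue_bounded_integrable (F : set R) (f : R -> R) (M : R) :
  measurable (F : set (lebesgueType R)) -> (leb R F < +oo)%E ->
  measurable_fun setT f -> (forall x, `|f x| <= M) ->
  (leb R).-integrable F (EFin \o f).
Proof.
move=> mF Ff mf fM; apply: measurable_bounded_integrable => //.
  exact: borel_fun_lebesgue.
exists M; split; first exact: num_real.
by move=> x Mx y _; apply: le_trans (fM y) (ltW Mx).
Qed.

Lemma Rintegral_indic (A F : set R) :
  measurable (A : set (lebesgueType R)) -> measurable (F : set (lebesgueType R)) ->
  \int[leb R]_(x in F) (\1_A x : R) = fine (leb R (A `&` F)).
Proof. by move=> mA mF; rewrite /Rintegral integral_indic. Qed.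

Lemma indic_integrable (A F : set R) :
  measurable (A : set (lebesgueType R)) -> measurable (F : set (lebesgueType R)) ->
  (leb R F < +oo)%E ->
  (leb R).-integrable F (EFin \o (\1_A : R -> R)).
Proof.
move=> mA mF Ff; apply: measurable_bounded_integrable => //.
exists 1; split; first exact: num_real.
by move=> y y1 x _; rewrite /= ger0_norm// indicE; case: (x \in A) => //=; lra.
Qed.

Lemma integrableZ_EFin d (T : measurableType d) (mu : {measure set T -> \bar R})
    (D : set T) (k : R) (f : T -> R) : measurable D ->
  mu.-integrable D (EFin \o f) -> mu.-integrable D (EFin \o (fun x => k * f x)).
Proof. by move=> mD fI; exact: integrableZl fI. Qed.

Lemma integrableB_EFin d (T : measurableType d) (mu : {measure set T -> \bar R})
    (D : set T) (f g : T -> R) : measurable D ->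
  mu.-integrable D (EFin \o f) -> mu.-integrable D (EFin \o g) ->
  mu.-integrable D (EFin \o (fun x => f x - g x)).
Proof. by move=> mD fI gI; exact: integrableB fI gI. Qed.

Lemma cos_affine_measurable (b t : R) :
  measurable_fun setT (fun x : R => cos (b * x + t)).
Proof.
apply: continuous_measurable_fun => x.
apply: (@continuous_comp _ _ _ (fun x => b * x + t) cos); last exact: continuous_cos.
by apply: cvgD; [apply: cvgMl_tmp | exact: cvg_cst].
Qed.

Lemma cos_linear_measurable (b : R) : measurable_fun setT (fun x : R => cos (b * x)).
Proof. by have := cos_affine_measurable b 0; under eq_fun do rewrite addr0. Qed.

Lemma sin_linear_measurable (b : R) : measurable_fun setT (fun x : R => sin (b * x)).
Proof.
apply: continuous_measurable_fun => x.
apply: (@continuous_comp _ _ _ (fun x => b * x) sin); last exact: continuous_sin.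
exact: cvgMl_tmp.
Qed.

Variables (F : set R) (a theta : R).
Hypothesis a0 : 0 < a.
Hypothesis mF : measurable (F : set (lebesgueType R)).
Hypothesis Fbd : bounded_set F.
Hypothesis Fcos : forall n : int,
  \int[leb R]_(x in F) cos (2 * pi * (theta + n%:~R / a) * x) = 0.
Hypothesis Fsin : forall n : int,
  \int[leb R]_(x in F) sin (2 * pi * (theta + n%:~R / a) * x) = 0.

Let Ffin : (leb R F < +oo)%E. Proof. exact: leb_bounded. Qed.

(** This is [sin (pi (x - x0) / a)^2], in the form that shows that multiplying by it moves a
    frequency by at most one step [1 / a]. *)
Let u x0 x : R := (1 - cos (2 * pi / a * x + - (2 * pi / a * x0))) / 2.

Let uE x0 x : u x0 x = sin (pi * (x - x0) / a) ^+ 2.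
Proof.
rewrite /u cos_half [X in sin X](_ : _ = pi * (x - x0) / a); first by field.
by field; rewrite gt_eqF.
Qed.

Let u01 x0 x : 0 <= u x0 x <= 1.
Proof.
rewrite /u; set c := cos _; have := cos_le1 (2 * pi / a * x + - (2 * pi / a * x0)).
have := cos_geN1 (2 * pi / a * x + - (2 * pi / a * x0)); rewrite -/c.
by move=> ? ?; apply/andP; split; lra.
Qed.

Let u_meas x0 : measurable_fun setT (u x0).
Proof.
by apply: measurable_funM => //; apply: measurable_funB => //; exact: cos_affine_measurable.
Qed.

Let int_cos n t :
  \int[leb R]_(x in F) cos (2 * pi * (theta + n%:~R / a) * x + t) = 0.
Proof.
under eq_Rintegral do rewrite cosD mulrC [X in _ - X]mulrC.
have Ic : (leb R).-integrable F
    (EFin \o (fun x => cos (2 * pi * (theta + n%:~R / a) * x))).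
  apply: (@lebesgue_bounded_integrable _ _ 1) => // [|x]; last exact: cos_max.
  exact: cos_linear_measurable.
have Is : (leb R).-integrable F
    (EFin \o (fun x => sin (2 * pi * (theta + n%:~R / a) * x))).
  apply: (@lebesgue_bounded_integrable _ _ 1) => // [|x]; last exact: sin_max.
  exact: sin_linear_measurable.
rewrite RintegralB//; [|exact: integrableZ_EFin Ic|exact: integrableZ_EFin Is].
by rewrite !RintegralZl// Fcos Fsin !mulr0 subrr.
Qed.

(** Horner induction on [p]. The integral is claimed for all [n] and [t], since a factor [u] mixes
    neighbouring frequencies and phases; measurability and boundedness are carried along to split
    the integrals. *)
Let poly_orthogonal x0 (p : {poly R}) :
  [/\ measurable_fun setT (fun x => p.[u x0 x]),
      exists M, forall x, `|p.[u x0 x]| <= M &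
      forall (n : int) t, \int[leb R]_(x in F)
        (p.[u x0 x] * cos (2 * pi * (theta + n%:~R / a) * x + t)) = 0].
Proof.
elim/poly_ind: p => [|q c [mq [M qM] q0]].
  split.
  - by under eq_fun do rewrite horner0; exact: measurable_cst.
  - by exists 0 => x; rewrite horner0 normr0.
  - move=> n t; under eq_Rintegral do rewrite horner0 mul0r.
    by rewrite Rintegral_cst// mul0r.
have pE x : (q * 'X + c%:P).[u x0 x] = q.[u x0 x] * u x0 x + c by rewrite !hornerE.
have qc_int n t : (leb R).-integrable F (EFin \o (fun x =>
    q.[u x0 x] * cos (2 * pi * (theta + n%:~R / a) * x + t))).
  apply: (@lebesgue_bounded_integrable _ _ M) => // [|x].
    by apply: measurable_funM => //; exact: cos_affine_measurable.
  rewrite normrM -[leRHS]mulr1; apply: ler_pM => //; exact: cos_max.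
have c_int n t : (leb R).-integrable F (EFin \o (fun x =>
    cos (2 * pi * (theta + n%:~R / a) * x + t))).
  apply: (@lebesgue_bounded_integrable _ _ 1) => // [|x]; last exact: cos_max.
  exact: cos_affine_measurable.
split.
- under eq_fun do rewrite pE.
  by apply: measurable_funD => //; apply: measurable_funM.
- exists (M + `|c|) => x; rewrite pE; apply: le_trans (ler_normD _ _) _.
  apply: lerD => //; rewrite normrM -[leRHS]mulr1; apply: ler_pM => //.
  by have /andP[h1 h2] := u01 x0 x; rewrite ger0_norm.
move=> n t.
set b := 2 * pi / a * x0.
(* With [u = (1 - cos B) / 2], the product formula gives [u cos A = cos A / 2 - cos (A + B) / 4 -
   cos (A - B) / 4]. *)
have E x : (q * 'X + c%:P).[u x0 x] * cos (2 * pi * (theta + n%:~R / a) * x + t) =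
  ((1 / 2 * (q.[u x0 x] * cos (2 * pi * (theta + n%:~R / a) * x + t))
  - 1 / 4 * (q.[u x0 x] * cos (2 * pi * (theta + (n + 1)%:~R / a) * x + (t - b))))
  - 1 / 4 * (q.[u x0 x] * cos (2 * pi * (theta + (n - 1)%:~R / a) * x + (t + b))))
  + c * cos (2 * pi * (theta + n%:~R / a) * x + t).
  rewrite pE {2}/u -/b.
  set A := 2 * pi * (theta + n%:~R / a) * x + t; set B := 2 * pi / a * x + - b.
  rewrite (_ : _ * x + (t - b) = A + B); last by rewrite /A /B intrD; field; rewrite gt_eqF.
  rewrite (_ : _ * x + (t + b) = A - B); last by rewrite /A /B intrB; field; rewrite gt_eqF.
  rewrite (cosD A B) (cosB A B); by field.
under eq_Rintegral do rewrite E.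
have I1 := integrableZ_EFin (1 / 2) mF (qc_int n t).
have I2 := integrableZ_EFin (1 / 4) mF (qc_int (n + 1) (t - b)).
have I3 := integrableZ_EFin (1 / 4) mF (qc_int (n - 1) (t + b)).
have I4 := integrableZ_EFin c mF (c_int n t).
have I12 := integrableB_EFin mF I1 I2; have I123 := integrableB_EFin mF I12 I3.
rewrite RintegralD// RintegralB// RintegralB//.
by rewrite !RintegralZl// !q0 int_cos !mulr0; lra.
Qed.

Lemma sin_poly_orthogonal (x0 : R) (p : {poly R}) :
  [/\ measurable_fun setT (fun x : R => p.[sin (pi * (x - x0) / a) ^+ 2]),
      exists M, forall x : R, `|p.[sin (pi * (x - x0) / a) ^+ 2]| <= M &
      forall t, \int[leb R]_(x in F)
        (p.[sin (pi * (x - x0) / a) ^+ 2] * cos (2 * pi * theta * x + t)) = 0].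
Proof.
have [mp [M pM] p0] := poly_orthogonal x0 p; split.
- by under eq_fun do rewrite -uE.
- by exists M => x; rewrite -uE.
- move=> t; rewrite -[RHS](p0 0 t); apply: eq_Rintegral => x _.
  by rewrite uE mul0r addr0.
Qed.

End fourier_uniqueness.

(** * Fourier uniqueness on a packing set *)

Section test_function_bounds.
Context {R : realType}.
Implicit Types (a r x theta : R) (k n : nat).

Lemma half_expr_lt (e : R) : 0 < e -> exists n : nat, (1 / 2) ^+ n < e.
Proof.
move=> e0; have e1 : 0 <= e^-1 by rewrite invr_ge0 ltW.
exists (Num.bound e^-1); rewrite div1r exprVn invf_plt ?posrE ?exprn_gt0//.
by apply: lt_trans (archi_boundP e1) _; rewrite -natrX ltr_nat ltn_expl.
Qed.

(** Supplies the parameter [k] of [peak]: the lower bound 2 serves far from the arc, and the upper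
    bound 3 near its centre. *)
Lemma exists_natmul_between (d : R) : 0 < d <= 1 ->
  exists k, 2 <= k%:R * d <= 3.
Proof.
move=> /andP[d0 d1]; have h : 0 <= 2 / d by rewrite divr_ge0// ltW.
exists (Num.truncn (2 / d)).+1; rewrite -ler_pdivrMr// ltW ?truncnS_gt//=.
have : (Num.truncn (2 / d))%:R * d <= 2 by rewrite -ler_pdivlMr// truncn_le.
by rewrite -natr1 mulrDl; lra.
Qed.

Lemma sin_sqr01 x : 0 <= sin x ^+ 2 <= 1.
Proof. by rewrite sqr_ge0 -(real_normK (num_real (sin _))) exprn_ile1// sin_max. Qed.

Lemma cos_ge_half theta r x0 x : 2 * pi * (`|theta| + 1) * r <= 1 ->
  `|x - x0| <= r -> 1 / 2 <= cos (2 * pi * theta * x + - (2 * pi * theta * x0)).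
Proof.
move=> thr xr; rewrite (_ : _ + _ = 2 * pi * theta * (x - x0)); last by ring.
set y := _ * (x - x0); apply: le_trans (cos_ge_quadratic y).
have pi0 := pi_ge0 R.
have y1 : `|y| <= 1.
  rewrite /y !normrM (ger0_norm pi0) (@ger0_norm _ 2)//.
  apply: le_trans thr; apply: ler_pM => //; first by rewrite !mulr_ge0.
  by rewrite ler_wpM2l ?mulr_ge0// lerDl.
have : y ^+ 2 <= 1 by rewrite -(real_normK (num_real y)) exprn_ile1.
by move: (y ^+ 2) => y2; lra.
Qed.

(** Within [r / 10] of [x0] the squared sine is at most [16 / 100] of [(pi r / (4 a))^2], so [k]
    times it is at most [0.48], below the threshold [1 / 2] of [peak_ge]. *)
Lemma peak_near a r k n x0 x : 0 < a -> k%:R * (pi * r / (4 * a)) ^+ 2 <= 3 ->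
  `|x - x0| <= r / 10 ->
  1 - (1 / 2) ^+ n <= (peak k n).[sin (pi * (x - x0) / a) ^+ 2].
Proof.
move=> a0 kd xr; apply: peak_ge; first exact: sin_sqr01.
have pi0 := pi_ge0 R.
have : sin (pi * (x - x0) / a) ^+ 2 <= 16 / 100 * (pi * r / (4 * a)) ^+ 2.
  apply: le_trans (sin_sqr_le _) _.
  have -> : 16 / 100 * (pi * r / (4 * a)) ^+ 2 = (pi * (r / 10) / a) ^+ 2.
    by field; rewrite gt_eqF.
  have h : `|pi * (x - x0) / a| <= pi * (r / 10) / a.
    rewrite !normrM normfV (ger0_norm pi0) (gtr0_norm a0).
    by apply: ler_wpM2r; [rewrite invr_ge0 ltW | exact: ler_wpM2l].
  have h0 := le_trans (normr_ge0 _) h.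
  by rewrite -(real_normK (num_real (_ / a))); apply: lerXn2r h; rewrite nnegrE.
move: kd (ler0n R k); set d := _ ^+ 2; set v := _ ^+ 2; set K := k%:R.
clear; nra.
Qed.

Lemma near_multiple a x : 0 < a -> exists j : int, `|x - a * j%:~R| <= a / 2.
Proof.
move=> a0; pose j : int := Num.floor (x / a + 1 / 2); exists j.
have j1 : j%:~R <= x / a + 1 / 2 by exact: floor_le.
have j2 : x / a + 1 / 2 < j%:~R + 1.
  by rewrite -[X in _ < _ + X]/(1%:~R) -intrD floorD1_gt.
have -> : x = x / a * a by rewrite divfK// gt_eqF.
move: (x / a) (j%:~R) j1 j2 => t J j1 j2.
by rewrite ler_norml; apply/andP; split; nra.
Qed.

(** Reducing [x - x0] modulo [a] gives [y] with [r <= |y| <= a / 2], where [sin_sqr_ge] applies. *)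
Lemma peak_far a r k n x0 x : 0 < a -> 0 <= r ->
  2 <= k%:R * (pi * r / (4 * a)) ^+ 2 ->
  (forall j : int, r <= `|x - x0 - a * j%:~R|) ->
  (peak k n).[sin (pi * (x - x0) / a) ^+ 2] <= (1 / 2) ^+ n.
Proof.
move=> a0 r0 kd far; apply: peak_le; first exact: sin_sqr01.
have pi0 := pi_ge0 R.
apply: le_trans kd _; apply: ler_wpM2l => //.
have [j ya] := near_multiple (x - x0) a0; have := far j => yr.
set y := x - x0 - _ in ya yr.
have -> : sin (pi * (x - x0) / a) ^+ 2 = sin (pi * y / a) ^+ 2.
  rewrite -(sin_sqr_periodic (pi * y / a) j); congr (sin _ ^+ 2).
  by rewrite /y; field; rewrite gt_eqF.
apply: le_trans (sin_sqr_ge _).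
  rewrite -(real_normK (num_real (_ / 4))).
  have h : pi * r / (4 * a) <= `|pi * y / a / 4|.
    rewrite !normrM !normfV (ger0_norm pi0) (gtr0_norm a0) (@gtr0_norm _ 4)//.
    rewrite (_ : pi * r / _ = pi / a / 4 * r); last by field; rewrite gt_eqF.
    rewrite (_ : pi * _ / a / 4 = pi / a / 4 * `|y|); last by field; rewrite gt_eqF.
    by apply: ler_wpM2l => //; rewrite !divr_ge0// ltW.
  apply: lerXn2r h; rewrite nnegrE//.
  by rewrite divr_ge0 ?mulr_ge0// ltW.
rewrite !normrM normfV (ger0_norm pi0) (gtr0_norm a0) ler_pdivrMr// -!mulrA.
by apply: ler_wpM2l => //; rewrite mulrC.
Qed.
End test_function_bounds.

(** * Sets with almost disjoint translates *)

Section packing.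
Context {R : realType}.

(** After shifting back by [t], a point of the overlap lies in [B]: either it is outside [F], or it
    lies in the null overlap of [F] with its own translate. *)
Lemma packing_overlap (F B : set R) (t : R) : leb R (F `&` translate F (- t)) = 0%E ->
  (leb R (F `&` translate B t) <= leb R (B `\` F))%E.
Proof.
move=> F0; rewrite -(leb_translate _ (- t)).
apply: le_trans (_ : leb R ((B `\` F) `|` (F `&` translate F (- t))) <= _)%E.
  apply: le_leb => x; rewrite /translate/= opprK addrK => -[Fx Bx].
  by have [?|?] := pselect (F x); [right | left].
by apply: le_trans (lebU_le _ _) _; rewrite F0 adde0.
Qed.

Definition arc (x0 r : R) : set R := `](x0 - r), (x0 + r)]%classic.

Lemma arc_far (x0 r x : R) : ~ arc x0 r x -> r <= `|x - x0|.
Proof.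
move=> nx; rewrite leNgt; apply/negP; rewrite ltr_norml => /andP[? ?].
by apply: nx; rewrite /arc/= in_itv/=; apply/andP; split; lra.
Qed.

Lemma arc_near (x0 r x : R) : arc x0 r x -> `|x - x0| <= r.
Proof.
by rewrite /arc/= in_itv/= ler_norml => /andP[? ?]; apply/andP; split; lra.
Qed.

(* Where F nearly fills an interval, it nearly avoids the translates of that
   interval by multiples of a. *)
Lemma packing_avoids (F : set R) (a : R) : 0 < a ->
  measurable (F : set (lebesgueType R)) -> bounded_set F ->
  (forall j : int, j != 0 -> leb R (F `&` translate F (a * j%:~R)) = 0%E) ->
  exists J : nat, forall x0 r e : R, 0 <= e -> r <= 1 ->
    (leb R (`](x0 - r)%R, (x0 + r)%R]%classic `\` F) <= e%:E)%E -> e < 2 * r ->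
    exists G : set R, [/\ measurable (G : set (lebesgueType R)),
      (leb R G <= (J%:R * e)%:E)%E &
      forall x, F x -> ~ `](x0 - r)%R, (x0 + r)%R]%classic x -> ~ G x ->
        forall j : int, r <= `|x - x0 - a * j%:~R|].
Proof.
move=> a0 mF Fbd pack; have [L L0 FL] := bounded_set_normr Fbd.
(* If [z] in [F] is in the arc and [x] in [F] is carried into it by [- a j], then
   [a |j| <= 2 L + 2 r]; hence [|j| <= N]. *)
have [N NL] : exists N : nat, (2 * L + 2) / a <= N%:R.
  have h : 0 <= (2 * L + 2) / a by rewrite divr_ge0//; lra.
  by exists (Num.bound ((2 * L + 2) / a)); apply/ltW/archi_boundP.
exists (2 * N).+1 => x0 r e e0 r1; rewrite -/(arc x0 r) => dens er.
have [z [Fz Bz]] : exists z, F z /\ arc x0 r z.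
  apply: contrapT => no; have : (leb R (arc x0 r) <= e%:E)%E.
    by apply: le_trans dens; apply: le_leb => x Bx; split => // Fx; apply: no; exists x.
  by rewrite leb_oc ?lee_fin; lra.
(* Index [i] stands for the multiple [j = i - N], from [-N] to [N]. The slot [j = 0] is left empty:
   it would be the arc itself, which the conclusion excludes. *)
pose G i := if i == N then set0 else
  F `&` translate (arc x0 r) (a * (Posz i - Posz N)%:~R).
exists (\big[setU/set0]_(i < (2 * N).+1) G i); split.
- apply: bigsetU_measurable => i _; rewrite /G; case: eqP => // _.
  by apply: measurableI => //; apply: translate_measurable; exact: itv_measurable.
- apply: le_trans (outer_measure_subadditive (mu_ext (@wlength R idfun)) _ _) _.
  apply: le_trans (_ : (\sum_(i < (2 * N).+1) e%:E <= _)%E); last first.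
    by rewrite sumEFin sumr_const card_ord lee_fin [leRHS]mulr_natl.
  apply: lee_sum => i _; rewrite -/(leb R (G i)) /G; case: eqP => [_|/eqP iN].
    by rewrite measure0 lee_fin.
  apply: le_trans (packing_overlap _ _) dens.
  rewrite -mulrN -intrN; apply: pack; rewrite oppr_eq0 subr_eq0.
  by apply: contra_neq iN => -[].
move=> x Fx nBx nGx j.
suff /arc_far : ~ arc x0 r (x - a * j%:~R) by rewrite addrAC.
move=> Bxj; apply: nGx; rewrite -(bigcup_mkord _ G).
have jN : `|j%:~R| <= N%:R :> R.
  apply: le_trans NL; rewrite ler_pdivlMr// -{1}(gtr0_norm a0) -normrM.
  have := FL _ Fx; have := FL _ Fz; move: (arc_near Bz) (arc_near Bxj).
  rewrite !ler_norml mulrC; clear -r1 => /andP[? ?] /andP[? ?] /andP[? ?] /andP[? ?].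
  by apply/andP; split; lra.
have {}jN : `|j| <= N%:Z by rewrite -(@ler_int R) intr_norm.
exists (absz (j + N%:Z)); first by rewrite /=; lia.
have jE : Posz (absz (j + N%:Z)) - Posz N = j by lia.
rewrite /G; case: eqP => [e1|_]; last by rewrite jE.
have j0 : j = 0 by lia.
by move: Bxj; rewrite j0 mulr0 subr0.
Qed.

(** Final arithmetic, with [b], [g], [m] the measures of the central arc in [F], of the bad part of
    [F], and of [F]. The gain is at least [b / 4 >= r / 20 - eta r / 2]. This last loss and [g]
    total at most [2 eta (J + 1) r = r / 40], and [ep m < r / 80], which leaves a positive
    amount. *)
Lemma packing_gain (J eta r ep b g m : R) : 0 <= J -> 0 < eta ->
  eta * (J + 1) = 1 / 80 -> 0 < r -> 0 < ep -> ep < 1 / 2 -> ep * m < r / 80 ->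
  0 <= b -> r / 5 <= b + eta * (2 * r) -> g <= J * (eta * (2 * r)) ->
  0 < (1 - ep) / 2 * b - g - ep * m.
Proof.
move=> J0 eta0 etaJ r0 ep0 ep1 epm b0 br gr.
have er : r * (eta * (J + 1)) = r * (1 / 80) by rewrite etaJ.
have b4 : 1 / 4 * b <= (1 - ep) / 2 * b by apply: ler_wpM2r => //; lra.
have : 0 <= eta * r by rewrite mulr_ge0// ltW.
by nra.
Qed.
(* Uniqueness of Fourier coefficients for x |-> e^(2 i pi theta x) 1_F, read
   modulo a: F fills almost all of some short arc, and a polynomial in
   sin^2(pi (x - x0) / a) close to the indicator function of that arc would
   have a positive integral against cos(2 pi theta (x - x0)). *)
Lemma packing_fourier_null (F : set R) (a theta : R) : 0 < a ->
  measurable (F : set (lebesgueType R)) -> bounded_set F ->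
  (forall j : int, j != 0 -> leb R (F `&` translate F (a * j%:~R)) = 0%E) ->
  (forall n : int, \int[leb R]_(x in F) cos (2 * pi * (theta + n%:~R / a) * x) = 0) ->
  (forall n : int, \int[leb R]_(x in F) sin (2 * pi * (theta + n%:~R / a) * x) = 0) ->
  leb R F = 0%E.
Proof.
move=> a0 mF Fbd pack Fcos Fsin; apply/eqP/negP => /negP Fn0.
have Ffin := leb_bounded Fbd.
have [J JP] := packing_avoids a0 mF Fbd pack.
pose eta : R := (80 * (J%:R + 1))^-1.
have J0 : 0 <= J%:R :> R := ler0n _ _.
have J1 : 0 < J%:R + 1 :> R by rewrite ltr_wpDl.
have eta0 : 0 < eta by rewrite invr_gt0 mulr_gt0.
have etaJ : eta * (J%:R + 1) = 1 / 80.
  by rewrite /eta invfM -mulrA mulVf ?mulr1 ?div1r// gt_eqF.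
have eta1 : eta <= 1 / 2.
  rewrite -(ler_pM2r J1) etaJ; clear -J0; lra.
have th0 : 0 < 2 * pi * (`|theta| + 1).
  by rewrite mulr_gt0 ?ltr_wpDl// mulr_gt0// pi_gt0.
have apos : 0 < a / pi by rewrite divr_gt0// pi_gt0.
(* The three bounds on [r] serve [packing_avoids], the condition [(pi r / (4 a))^2 <= 1], and the
   bound [cos >= 1 / 2] on the arc. *)
have r00 : 0 < Num.min (Num.min 1 (a / pi)) (2 * pi * (`|theta| + 1))^-1.
  by rewrite !lt_min ltr01 apos invr_gt0.
have etaI : 0 < eta <= 1 / 2 by rewrite eta0.
have [x0 [r [rgt0 + dens]]] := leb_dense_interval mF Fn0 etaI r00.
rewrite !lt_min => /andP[/andP[r1 rap]].
rewrite -div1r ltr_pdivlMr// mulrC => /ltW rth.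
have r2 : 0 < 2 * r by rewrite mulr_gt0.
have e0 : 0 <= eta * (2 * r) by rewrite mulr_ge0// ltW.
have er : eta * (2 * r) < 2 * r by rewrite gtr_pMl//; clear -eta1; lra.
have [G [mG lG far]] := JP _ _ _ e0 (ltW r1) dens er.
rewrite -/(arc x0 r) in dens far.
pose B' := arc x0 (r / 10).
have r10 : r / 10 <= r by clear -rgt0; lra.
have B'B : B' `<=` arc x0 r.
  move=> x; rewrite /B' /arc/= !in_itv/= => /andP[x1 x2].
  by apply/andP; split; clear -r10 x1 x2; lra.
have lB' : leb R B' = (r / 5)%:E.
  by clear -rgt0; rewrite leb_oc; [congr EFin; field | lra].
have mB' : measurable (B' : set (lebesgueType R)) by exact: itv_measurable.
have dI : 0 < (pi * r / (4 * a)) ^+ 2 <= 1.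
  have h : 0 < pi * r / (4 * a) by rewrite divr_gt0 ?mulr_gt0// pi_gt0.
  rewrite exprn_gt0//= exprn_ile1 ?(ltW h)// ler_pdivrMr ?mulr_gt0// mul1r.
  move: rap; rewrite ltr_pdivlMr ?pi_gt0// mulrC; clear -a0; lra.
have [k /andP[k2 k3]] := exists_natmul_between dI.
pose m := fine (leb R F).
have m0 : 0 <= m by rewrite fine_ge0.
(* The exponent [n] makes the error [ep] of the peak so small that its total over [F] stays below
   [r / 80]. *)
have [n] : exists n : nat, (1 / 2) ^+ n < Num.min (1 / 2) (r / 80 / (m + 1)) :> R.
  by apply: half_expr_lt; rewrite lt_min !divr_gt0// ltr_wpDl.
rewrite lt_min; set ep : R := (1 / 2) ^+ n => /andP[ep1 ep2].
have ep0 : 0 < ep by rewrite exprn_gt0.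
have {}ep2 : ep * m < r / 80.
  move: ep2; rewrite ltr_pdivlMr ?ltr_wpDl//; apply: le_lt_trans.
  by rewrite ler_wpM2l ?lerDl// ltW.
have [mQ [Q1 QQ1] Qint] := sin_poly_orthogonal a0 mF Fbd Fcos Fsin x0 (peak k n).
have {}Qint := Qint (- (2 * pi * theta * x0)).
pose q x := (peak k n).[sin (pi * (x - x0) / a) ^+ 2].
pose c x := cos (2 * pi * theta * x + - (2 * pi * theta * x0)).
pose h x := q x * c x.
(* A step function below [h] on [F]: on [B'] the peak is at least [1 - ep] and the cosine at least
   [1 / 2]; on the rest of the arc [h >= 0]; on [G] outside the arc [h >= -1]; elsewhere the peak is
   at most [ep]. *)
pose w x := ((1 - ep) / 2 * \1_B' x - \1_G x) - ep.
have wh x : F x -> w x <= h x.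
  move=> Fx; rewrite /w /h.
  have /andP[q0 q1] : 0 <= q x <= 1 by apply: peak01; exact: sin_sqr01.
  have c1 : -1 <= c x := cos_geN1 _.
  have indG : 0 <= (\1_G x : R) by rewrite indicE; case: (x \in G).
  have [Bx|nBx] := pselect (arc x0 r x).
    have ch : 1 / 2 <= c x by apply: cos_ge_half rth _; exact: arc_near.
    have [B'x|nB'x] := pselect (B' x); last first.
      rewrite [\1_B' _]indicE memNset//= mulr0; clear -q0 ch indG ep0; nra.
    have : 1 - ep <= q x by apply: peak_near k3 _ => //; exact: arc_near.
    rewrite [\1_B' _]indicE mem_set//= mulr1; clear -q0 ch indG ep0; nra.
  have nB'x : ~ B' x by move=> /B'B.
  rewrite [\1_B' _]indicE memNset//= mulr0.
  have [Gx|nGx] := pselect (G x).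
    by rewrite indicE mem_set//=; clear -q0 q1 c1 ep0; nra.
  have : q x <= ep.
    by apply: peak_far k2 _ => //; [exact: ltW | exact: far].
  by rewrite indicE memNset//=; clear -q0 c1; nra.
have hI : (leb R).-integrable F (EFin \o h).
  apply: (@lebesgue_bounded_integrable _ F h Q1) => // [|x].
    by apply: measurable_funM => //; exact: cos_affine_measurable.
  by rewrite /h normrM -[leRHS]mulr1; apply: ler_pM => //; [exact: QQ1 | exact: cos_max].
have IB' := indic_integrable mB' mF Ffin.
have IG := indic_integrable mG mF Ffin.
have Icst : (leb R).-integrable F (EFin \o (fun=> ep)).
  exact: (@lebesgue_bounded_integrable _ F (fun=> ep) `|ep|).
have IB1 := integrableZ_EFin ((1 - ep) / 2) mF IB'.
have IB2 := integrableB_EFin mF IB1 IG.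
(* The integral of [h] is 0 by orthogonality, while that of [w] is positive by [packing_gain]. *)
have := le_Rintegral mF (integrableB_EFin mF IB2 Icst) hI wh.
rewrite [leRHS]Qint RintegralB// RintegralB// RintegralZl// Rintegral_cst//.
rewrite !Rintegral_indic//.
rewrite -/m; apply/negP; rewrite -ltNge.
have finI (A : set R) : leb R (A `&` F) = (fine (leb R (A `&` F)))%:E.
  by rewrite fineK// ge0_fin_numE//; apply: le_lt_trans Ffin; apply: le_leb => x [].
apply: (packing_gain J0 eta0 etaJ rgt0 ep0 ep1 ep2).
- by rewrite fine_ge0.
- rewrite -lee_fin -lB' EFinD -finI; apply: le_trans (leeD2l _ dens).
  apply: le_trans (lebU_le _ _); apply: le_leb => x B'x.
  by have [Fx|Fx] := pselect (F x); [left | right; split => //; exact: B'B].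
- by rewrite -lee_fin -finI; apply: le_trans lG; apply: le_leb => x [].
Qed.
End packing.

(** * Square-integrable functions *)

Section L2_facts.
Context {d : measure_display} {T : measurableType d} {R : realType}.
Variables (mu : {measure set T -> \bar R}) (D : set T).
Hypothesis mD : measurable D.
Implicit Types (f g : T -> R[i]).

Definition normC2 (z : R[i]) : R := complex.Re z ^+ 2 + complex.Im z ^+ 2.

Lemma normC2_ge0 z : 0 <= normC2 z.
Proof. by rewrite addr_ge0// sqr_ge0. Qed.

Lemma normC2M z w : normC2 (z * w) = normC2 z * normC2 w.
Proof. by case: z w => [x y] [u v]; rewrite /normC2/=; ring. Qed.

Lemma normC2D z w : normC2 (z + w) <= 2 * normC2 z + 2 * normC2 w.
Proof.
case: z w => [x y] [u v]; rewrite /normC2/= !expr2.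
have := sqr_ge0 (x - u); have := sqr_ge0 (y - v); rewrite !expr2; lra.
Qed.

Lemma L2normE f : L2norm mu D f = Num.sqrt (\int[mu]_(x in D) normC2 (f x)).
Proof.
rewrite /L2norm /inner /cintegral/=; congr Num.sqrt; apply: eq_Rintegral => x _.
by case: (f x) => u v; rewrite /normC2/=; ring.
Qed.

Lemma ReM (z w : R[i]) : complex.Re (z * w) =
  complex.Re z * complex.Re w - complex.Im z * complex.Im w.
Proof. by case: z w => [? ?] [? ?]. Qed.

Lemma ImM (z w : R[i]) : complex.Im (z * w) =
  complex.Re z * complex.Im w + complex.Im z * complex.Re w.
Proof. by case: z w => [? ?] [? ?]. Qed.

Lemma L2D f g : L2 mu D f -> L2 mu D g -> L2 mu D (fun x => f x + g x).
Proof.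
move=> [mf1 mf2 fI] [mg1 mg2 gI].
have m1 : measurable_fun D (fun x => complex.Re (f x + g x)).
  under eq_fun do rewrite raddfD/=; exact: measurable_funD.
have m2 : measurable_fun D (fun x => complex.Im (f x + g x)).
  under eq_fun do rewrite raddfD/=; exact: measurable_funD.
split => //.
apply: (le_integrable mD _ _
  (integrableD mD (integrableZl mD 2 fI) (integrableZl mD 2 gI))).
- by apply/measurable_EFinP; apply: measurable_funD; apply: measurable_funX.
- move=> x _; rewrite /= lee_fin -/(normC2 _) -/(normC2 (f x)) -/(normC2 (g x)).
  rewrite (ger0_norm (normC2_ge0 _)); apply: le_trans (normC2D _ _) _.
  exact: ler_norm.
Qed.

Lemma L2Z (c : R[i]) f : L2 mu D f -> L2 mu D (fun x => c * f x).
Proof.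
move=> [mf1 mf2 fI].
split.
- under eq_fun do rewrite ReM.
  by apply: measurable_funB; apply: measurable_funM.
- under eq_fun do rewrite ImM.
  by apply: measurable_funD; apply: measurable_funM.
- have := integrableZl mD (normC2 c) fI; apply: eq_integrable => // x _ /=.
  by rewrite -EFinM; congr EFin; exact/esym/normC2M.
Qed.

Lemma L2B f g : L2 mu D f -> L2 mu D g -> L2 mu D (fun x => f x - g x).
Proof.
move=> fL /(L2Z (-1)) gL; have := L2D fL gL.
by rewrite (_ : (fun x => _) = (fun x => f x - g x))//; apply/funext => x; rewrite mulN1r.
Qed.

Lemma L2_0 : L2 mu D (fun=> 0).
Proof.
split; [exact: measurable_cst | exact: measurable_cst |].
by rewrite /= expr0n addr0; exact: integrable0.
Qed.

Lemma L2_sum (I : eqType) (s : seq I) (F : I -> T -> R[i]) :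
  (forall i, i \in s -> L2 mu D (F i)) -> L2 mu D (fun x => \sum_(i <- s) F i x).
Proof.
elim: s => [|i s IH] Fs.
  by under eq_fun do rewrite big_nil; exact: L2_0.
under eq_fun do rewrite big_cons; apply: L2D.
  by apply: Fs; rewrite mem_head.
by apply: IH => j js; apply: Fs; rewrite inE js orbT.
Qed.

End L2_facts.

Section L2_lebesgue.
Context {R : realType}.

(** Chebyshev's inequality: the indicator function of [E] is at most [normC2 f]. *)
Lemma L2norm_ge_measure d (T : measurableType d) (mu : {measure set T -> \bar R})
    (E : set T) (f : T -> R[i]) (e : R) :
  measurable E -> L2 mu setT f -> (forall x, E x -> 1 <= normC2 (f x)) ->
  L2norm mu setT f < e -> (mu E <= (e ^+ 2)%:E)%E.
Proof.
move=> mE fL fE; rewrite L2normE => fe.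
have [m1 m2 fI] := fL.
have I0 : 0 <= \int[mu]_x normC2 (f x) by apply: Rintegral_ge0 => x _; exact: normC2_ge0.
have fe2 : \int[mu]_x normC2 (f x) <= e ^+ 2.
  rewrite -[leLHS]sqr_sqrtr//; apply: lerXn2r; rewrite ?nnegrE ?sqrtr_ge0 ?(ltW fe)//.
  exact: le_trans (sqrtr_ge0 _) (ltW fe).
have Ifin : (\int[mu]_x (normC2 (f x))%:E)%E \is a fin_num by exact: integrable_fin_num fI.
apply: le_trans (_ : (\int[mu]_x (normC2 (f x))%:E)%E <= _)%E; last first.
  by rewrite -(fineK Ifin) lee_fin.
rewrite -{1}(setIT E) -integral_indic//.
apply: ge0_le_integral => //.
- by apply/measurable_EFinP; exact: measurable_indic.
- by case/integrableP: fI.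
- move=> x _; rewrite lee_fin indicE; have [Ex|Ex] := pselect (E x).
    by rewrite mem_set//; exact: fE.
  by rewrite memNset// normC2_ge0.
Qed.
End L2_lebesgue.

(** * Lower triangular lattices *)

Section lower_triangular_gabor.
Context {R : realType}.
Variables (K : set R) (a d : R) (L : set 'cV[R]_2).
Hypothesis K_bounded : bounded_set K.
Hypothesis K_measurable : measurable (K : set (lebesgueType R)).
Hypothesis K_pos : (0 < leb R K)%E.
Hypothesis a0 : 0 < a.

Let freq (m n : int) : R := d * m%:~R + n%:~R / a.
Let pt (m n : int) : 'cV[R]_2 :=
  \col_i (if i == ord0 then a * m%:~R else freq m n).

Hypothesis LP : forall p, L p <-> exists m n, p = pt m n.
Hypothesis K_gabor : gabor_orthonormal_basis (normalized_indicator K) L.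

Let Kt (m : int) : set R := translate K (a * m%:~R).
Let kappa : R := (Num.sqrt (fine (leb R K)))^-1.
Let e (m n : int) : R -> R[i] := tf_shift (pt m n) (normalized_indicator K).

Let K_fin : (leb R K < +oo)%E. Proof. exact: leb_bounded. Qed.

Let kappa_gt0 : 0 < kappa.
Proof. by rewrite invr_gt0 sqrtr_gt0 fine_gt0// K_pos. Qed.

Let mKt m : measurable (Kt m : set (lebesgueType R)).
Proof. exact: translate_measurable. Qed.

Let Kt0 : Kt 0 = K.
Proof. by apply/seteqP; split => x; rewrite /Kt /translate/= mulr0 subr0. Qed.

Let indic_translate (x t : R) : \1_K (x - t) = \1_(translate K t) x :> R.
Proof. by rewrite !indicE. Qed.

Let eE m n x : e m n x = (kappa * \1_(Kt m) x * cos (2 * pi * freq m n * x)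
  +i* (kappa * \1_(Kt m) x * sin (2 * pi * freq m n * x)))%C.
Proof.
rewrite /e /tf_shift !mxE/= /normalized_indicator indic_translate -/(Kt m) -/kappa.
by apply/eqP; rewrite eq_complex /expi/=; apply/andP; split; apply/eqP; ring.
Qed.

Let Lpt m n : L (pt m n). Proof. by apply/LP; exists m, n. Qed.

Let mul_indic (A B : set R) x : \1_A x * \1_B x = \1_(A `&` B) x :> R.
Proof. by rewrite indicI. Qed.

(** The inner product of two Gabor functions is [kappa ^ 2] times the integral of an exponential, at
    the difference of the frequencies, over the overlap of the supports. *)
Let gabor_orthogonal m n m' n' : pt m n <> pt m' n' ->
  \int[leb R]_(x in Kt m `&` Kt m') cos (2 * pi * (freq m n - freq m' n') * x) = 0 /\
  \int[leb R]_(x in Kt m `&` Kt m') sin (2 * pi * (freq m n - freq m' n') * x) = 0.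
Proof.
move=> ne; have [[_ orth _] _] := K_gabor.
have : inner (leb R) setT (e m n) (e m' n') = 0.
  exact: orth _ _ (Lpt m n) (Lpt m' n') ne.
rewrite /inner /cintegral => /eqP; rewrite eq_complex => /andP[/eqP h1 /eqP h2].
have {}h1 : \int[leb R]_x complex.Re (e m n x * (e m' n' x)^*%C) = 0 := h1.
have {}h2 : \int[leb R]_x complex.Im (e m n x * (e m' n' x)^*%C) = 0 := h2.
have mI : measurable (Kt m `&` Kt m' : set (lebesgueType R)) by exact: measurableI.
have fI : (leb R (Kt m `&` Kt m') < +oo)%E.
  by apply: le_lt_trans K_fin; rewrite -(leb_translate K (a * m%:~R)); apply: le_leb => x [].
have k2 : kappa ^+ 2 != 0 by rewrite expf_neq0// gt_eqF.
have key (f : R -> R) : measurable_fun setT f -> (forall x, `|f x| <= 1) ->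
    \int[leb R]_x (kappa ^+ 2 * (f x * \1_(Kt m `&` Kt m') x)) = 0 ->
    \int[leb R]_(x in Kt m `&` Kt m') f x = 0.
  move=> mf f1 f0; have intf := lebesgue_bounded_integrable mI fI mf f1.
  have restrE : f \_ (Kt m `&` Kt m') = (fun x => f x * \1_(Kt m `&` Kt m') x).
    apply/funext => x; rewrite patchE indicE; case: ifP => _ /=; first by rewrite mulr1.
    by rewrite mulr0.
  rewrite Rintegral_mkcond restrE.
  move: f0; rewrite RintegralZl//; first by move/eqP; rewrite mulf_eq0 (negPf k2) => /eqP.
  rewrite -restrE.
  have := intf; rewrite integrable_mkcond//.
  by rewrite restrict_EFin.
split; apply: key.
- exact: cos_linear_measurable.
- by move=> x; exact: cos_max.
- rewrite -[RHS]h1; apply: eq_Rintegral => x _.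
  rewrite !eE/= -mul_indic mulrBr mulrBl cosB; ring.
- exact: sin_linear_measurable.
- by move=> x; exact: sin_max.
- rewrite -[RHS]h2; apply: eq_Rintegral => x _.
  rewrite !eE/= -mul_indic mulrBr mulrBl sinB; ring.
Qed.

Let overlap_shift (m j : int) : leb R (Kt m `&` Kt (m + j)) = leb R (K `&` Kt j).
Proof.
rewrite -(leb_translate (K `&` Kt j) (a * m%:~R)); congr (leb R _).
apply/seteqP; split => x; rewrite /Kt /translate/= intrD mulrDr opprD addrA;
  by [].
Qed.

Let overlap_pos_null (m : nat) : (0 < m)%N -> leb R (K `&` Kt m) = 0%E.
Proof.
have [B B0 KB] := bounded_set_normr K_bounded.
pose m0 := Num.bound (2 * B / a).
have m0P : 2 * B / a < m0%:R by apply: archi_boundP; rewrite divr_ge0 ?mulr_ge0 ?ltW.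
(* The descending induction on [m] becomes an induction on [i] under [m0 <= m + i]. At [i = 0] the
   shift [a m] exceeds [2 B], so the overlap is empty. *)
have : (m0 <= m + m0)%N by rewrite leq_addl.
move: {2}m0 => i; elim: i m => [|i IH] m.
  rewrite addn0 => mm0 m1; rewrite (_ : _ `&` _ = set0) ?measure0//.
  apply/seteqP; split => x //= -[/KB xB]; rewrite /Kt /translate/= => /KB xmB; exfalso.
  have : (m0%:R : R) <= m%:R by rewrite ler_nat.
  have : m%:R <= 2 * B / a; last by lra.
  rewrite ler_pdivlMr//; move: xB xmB; rewrite !ler_norml -pmulrn mulrC.
  by move=> /andP[? ?] /andP[? ?]; lra.
move=> mi m1.
have IHp (j : nat) : (0 < j)%N -> leb R (K `&` Kt (m + j)%N) = 0%E.
  by move=> j0; apply: IH; [lia | lia].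
have F0 (j : nat) : (0 < j)%N ->
    leb R ((K `&` Kt m) `&` translate (K `&` Kt m) (a * j%:~R)) = 0%E.
  move=> j0; apply: leb_null_sub (IHp _ j0) => x [[Kx _]].
  rewrite /Kt /translate/= => -[_ h]; split => //.
  by rewrite PoszD intrD mulrDr opprD (addrC (- _)) addrA.
apply: (@packing_fourier_null R (K `&` Kt m) a (d * m%:~R)) => //.
- exact: measurableI.
- by have [B1 [B1r BK]] := K_bounded; exists B1; split => // x Bx y [Ky _]; exact: BK Bx y Ky.
(* For negative [j], shifting the overlap by [- a j] reduces to the positive case. *)
- move=> j j0; have [jp|jn] := leP 0 j.
    by have := F0 `|j|%N; rewrite absz_gt0 j0 gez0_abs// => ->.
  rewrite setIC -(leb_translate _ (- (a * j%:~R))).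
  have jE : j = - Posz `|j|%N by rewrite ltz0_abs// opprK.
  rewrite jE intrN mulrN opprK.
  rewrite -[RHS](F0 `|j|%N) ?absz_gt0//; congr (leb R _).
  apply/seteqP; split => x; rewrite /translate/= opprK subrK => -[[? ?] [? ?]];
    by split; split.
(* Orthogonality of the points [(m, n)] and [(0, 0)], whose frequencies differ by [d m + n / a]. *)
- move=> n; have [|h _] := @gabor_orthogonal m n 0 0.
    move/colP/(_ ord0); rewrite !mxE/= mulr0 => /eqP; rewrite mulf_eq0 gt_eqF//=.
    by rewrite intr_eq0; lia.
  by move: h; rewrite Kt0 setIC /freq mulr0 mul0r addr0 subr0.
- move=> n; have [|_ h] := @gabor_orthogonal m n 0 0.
    move/colP/(_ ord0); rewrite !mxE/= mulr0 => /eqP; rewrite mulf_eq0 gt_eqF//=.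
    by rewrite intr_eq0; lia.
  by move: h; rewrite Kt0 setIC /freq mulr0 mul0r addr0 subr0.
Qed.

Let overlap_null (m m' : int) : m != m' -> leb R (Kt m `&` Kt m') = 0%E.
Proof.
move=> ne; wlog lt_mm' : m m' ne / m < m'.
  move=> wl; case: (ltgtP m m') => [lt|gt|eq]; first exact: wl ne lt.
    by rewrite setIC; apply: wl gt; rewrite eq_sym.
  by rewrite eq eqxx in ne.
have j0 : 0 < m' - m by rewrite subr_gt0.
rewrite (_ : m' = m + `|m' - m|%N); last by lia.
by rewrite overlap_shift overlap_pos_null// absz_gt0 gt_eqF.
Qed.

Let overlaps : set R := \bigcup_(p in [set p : int * int | p.1 != p.2])
  (Kt p.1 `&` Kt p.2).

Let overlaps_null : leb R overlaps = 0%E.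
Proof.
pose F (p : int * int) := if p.1 != p.2 then Kt p.1 `&` Kt p.2 else set0.
apply: (@leb_null_sub _ _ (\bigcup_p F p)).
  by move=> x [p /= pp px]; exists p => //; rewrite /F pp.
apply: leb_bigcup_count0 => p; rewrite /F; case: ifPn => [pp|_].
  exact: overlap_null.
by rewrite measure0.
Qed.

Let overlaps_measurable : measurable (overlaps : set (lebesgueType R)).
Proof.
have -> : overlaps = \bigcup_p
    (if p.1 != p.2 then Kt p.1 `&` Kt p.2 else set0).
  by rewrite /overlaps bigcup_mkcond; apply: eq_bigcupr => p _; rewrite mem_setE.
apply: countable_bigcupT_measurable => [|p]; first exact: countableP.
by case: ifP => _ //; exact: measurableI.
Qed.

Let uncovered : set R := ~` \bigcup_m Kt m.

Let m_uncovered : measurable (uncovered : set (lebesgueType R)).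
Proof.
apply: measurableC; apply: countable_bigcupT_measurable => // m.
Qed.

Let uncovered_null : leb R uncovered = 0%E.
Proof.
(* Bounded windows keep the measure finite, so that the indicator function of [E] is in [L2]. *)
suff uN (N : nat) : leb R (uncovered `&` `](- N%:R)%R, N%:R]%classic) = 0%E.
  apply: leb_null_sub (leb_bigcup0 uN) => x ux.
  exists (Num.bound `|x|) => //; split => //=; rewrite in_itv/=.
  by have := archi_boundP (normr_ge0 x); rewrite ltr_norml => /andP[-> /ltW].
set E := _ `&` _.
have mE : measurable (E : set (lebesgueType R)).
  by apply: measurableI => //; exact: itv_measurable.
have Ef : (leb R E < +oo)%E.
  apply: (@le_lt_trans _ _ (leb R `](- N%:R)%R, N%:R]%classic)).
    by apply: le_leb => x [].
  by rewrite leb_oc ?ltry//; have := ler0n R N; lra.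
have EL : L2 (leb R) setT (fun x => (\1_E x)%:C%C).
  split => /=; [exact: measurable_indic | exact: measurable_cst |].
  under eq_fun do rewrite expr0n/= addr0.
  have : (leb R).-integrable E (EFin \o cst 1).
    exact: (@lebesgue_bounded_integrable _ E (cst 1) `|1|).
  rewrite integrable_mkcond//; apply: eq_integrable => // x _.
  by rewrite patchE indicE/=; case: ifP => _; rewrite ?expr1n ?expr0n.
have eps_le (eps : R) : 0 < eps -> (leb R E <= (eps ^+ 2)%:E)%E.
  move=> eps0; have [[eL _ dense] _] := K_gabor.
  have [s [c [sL]]] := dense _ eps EL eps0.
  move=> nf; apply: (@L2norm_ge_measure _ _ _ (leb R) E _ eps mE _ _ nf).
    apply: (L2B measurableT EL); apply: (L2_sum measurableT) => p /sL Lp.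
    by apply: (L2Z measurableT); exact: (eL p Lp).1.
  (* All Gabor functions vanish on [E], so any combination of them misses the indicator function by
     exactly 1 there. *)
  move=> x Ex; have [ux _] := Ex; rewrite big1_seq ?subr0.
    by rewrite indicE mem_set// /normC2/= expr1n expr0n/= addr0.
  move=> p /andP[_ /sL /LP [m [n ->]]].
  rewrite -/(e m n) eE indicE memNset; last by move=> Kx; apply: ux; exists m.
  by rewrite mulr0 !mul0r; apply/eqP; rewrite mulf_eq0 eqxx orbT.
apply/eqP; rewrite eq_le measure_ge0 andbT; apply/lee_addgt0Pr => eps eps0.
by rewrite add0e -(sqr_sqrtr (ltW eps0)); apply: eps_le; rewrite sqrtr_gt0.
Qed.

Lemma gabor_tiles : tiles K.
Proof.
exists [set a * m%:~R | m in [set: int]]; split.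
  by apply: sub_countable (card_image_le _ _) _; exact: countableP.
exists (overlaps `|` uncovered); split.
- exact: measurableU.
- apply/eqP; rewrite eq_le measure_ge0 andbT; apply: le_trans (lebU_le _ _) _.
  by rewrite overlaps_null uncovered_null adde0.
move=> x /= nx; apply: contrapT => /not_orP[nov ncov]; apply: nx.
have [m _ Kmx] : (\bigcup_m Kt m) x by exact: contrapT.
(* Off the overlaps, [x] lies in a single [Kt m]. Since the tiling sum uses [x + t], the only
   nonzero term is [t = - a m]. *)
have KxE (j : int) : K (x + a * j%:~R) -> j = - m.
  move=> Kxj; apply/eqP; rewrite eq_sym; apply/negPn/negP => jm; apply: nov.
  exists (m, - j); first by rewrite /= -eqr_oppLR.
  by split => //=; rewrite /Kt /translate/= intrN mulrN opprK.
have Kx0 : K (x - a * m%:~R) by [].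
rewrite (esumID [set a * (- m)%:~R]); last by move=> t _; rewrite lee_fin.
rewrite [X in (_ + X)%E]esum1 ?adde0; last first.
  move=> _ [[j _ <-] /= jm]; rewrite indicE memNset// => /KxE ?; subst j; exact: jm.
rewrite (_ : _ `&` _ = [set a * (- m)%:~R]); last first.
  by apply/seteqP; split => [t [] //|t ->]; split => //; exists (- m).
by rewrite esum_set1 ?lee_fin// indicE mem_set// intrN mulrN.
Qed.

Let normC2_expi (t : R) : normC2 (expi t) = 1.
Proof. exact: cos2Dsin2. Qed.

Let expi_L2 (gamma : R) : L2 (leb R) K (fun x : R => expi (2 * pi * gamma * x)).
Proof.
split.
- by apply: borel_fun_lebesgue => //; exact: cos_linear_measurable.
- by apply: borel_fun_lebesgue => //; exact: sin_linear_measurable.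
have -> : (fun x : lebesgueType R => (complex.Re (expi (2 * pi * gamma * x)) ^+ 2 +
    complex.Im (expi (2 * pi * gamma * x)) ^+ 2)%:E) = EFin \o cst 1.
  by apply/funext => x; congr EFin; exact: normC2_expi.
exact: (@lebesgue_bounded_integrable _ K (cst 1) `|1|).
Qed.

Let expi_norm (gamma : R) :
  L2norm (leb R) K (fun x : R => expi (2 * pi * gamma * x)) != 0.
Proof.
rewrite L2normE; under eq_Rintegral do rewrite normC2_expi.
by rewrite Rintegral_cst// mul1r gt_eqF// sqrtr_gt0 fine_gt0// K_pos.
Qed.

Let expi_orthogonal (n n' : int) : n%:~R / a <> n'%:~R / a :> R ->
  inner (leb R) K (fun x : R => expi (2 * pi * (n%:~R / a) * x))
                  (fun x : R => expi (2 * pi * (n'%:~R / a) * x)) = 0.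
Proof.
move=> ne; have [|h1 h2] := @gabor_orthogonal 0 n 0 n'.
  by move/colP/(_ ord_max); rewrite !mxE/= /freq => /addrI.
move: h1 h2; rewrite setIid Kt0 /freq !mulr0 !add0r => h1 h2.
rewrite /inner /cintegral.
rewrite -[LHS]/((_ +i* _)%C); congr (_ +i* _)%C.
  rewrite -[RHS]h1; apply: eq_Rintegral => x _ /=.
  by rewrite mulrBr mulrBl cosB; ring.
rewrite -[RHS]h2; apply: eq_Rintegral => x _ /=.
by rewrite mulrBr mulrBl sinB; ring.
Qed.

(** Extension by zero lets the density of Gabor functions on the whole line be applied to a function
    on [K]. *)
Let extend0_L2 (f : R -> R[i]) : L2 (leb R) K f ->
  L2 (leb R) setT (fun x => if x \in K then f x else 0).
Proof.
move=> [mre mim fI]; split.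
- move/(measurable_restrictT _ K_measurable) : mre.
  by congr (measurable_fun _ _); apply/funext => x; rewrite patchE; case: ifP.
- move/(measurable_restrictT _ K_measurable) : mim.
  by congr (measurable_fun _ _); apply/funext => x; rewrite patchE; case: ifP.
- move: fI; rewrite integrable_mkcond//; apply: eq_integrable => // x _.
  by rewrite patchE/=; case: ifP => //= _; rewrite expr0n addr0.
Qed.

Lemma gabor_spectral : spectral K.
Proof.
split => //; first by rewrite K_pos.
exists [set n%:~R / a | n in [set: int]]; split.
  by apply: sub_countable (card_image_le _ _) _; exact: countableP.
split.
- by move=> gamma _; split; [exact: expi_L2 | exact: expi_norm].
- by move=> _ _ [n _ <-] [n' _ <-]; exact: expi_orthogonal.
move=> f eps fL eps0; have [[eL _ dense] _] := K_gabor.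
have f0L := extend0_L2 fL.
have [s [c [sL]]] := dense _ eps f0L eps0.
set h := (fun x => _ - _) => hlt.
have hL : L2 (leb R) setT h.
  apply: (L2B measurableT f0L); apply: (L2_sum measurableT) => p /sL Lp.
  by apply: (L2Z measurableT); exact: (eL p Lp).1.
(* Only lattice points of first coordinate 0 are kept. On [K] their Gabor functions are [kappa]
   times exponentials, which explains the factor [kappa] in [c']. *)
pose s' := [seq p ord_max ord0 | p : 'cV[R]_2 <- s & p ord0 ord0 == 0].
pose c' (gamma : R) := kappa%:C%C * c (\col_i (if i == ord0 then 0 else gamma)).
exists s', c'; split.
  move=> gamma /mapP[p]; rewrite mem_filter => /andP[p0 /sL /LP[m [n pE]]] ->.
  exists n => //; move: p0; rewrite pE !mxE/= mulf_eq0 gt_eqF//= => /eqP m0.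
  by rewrite /freq m0 mulr0 add0r.
set h' := (fun x => _ - _).
have h'L : L2 (leb R) K h'.
  apply: (L2B K_measurable fL); apply: (L2_sum K_measurable) => gamma _.
  by apply: (L2Z K_measurable); exact: expi_L2.
(* A discarded term has [m != 0]; were it nonzero at a point of [K], that point would lie in [K] and
   [Kt m], hence in [overlaps]. *)
have hh' x : K x -> ~ overlaps x -> h' x = h x.
  move=> Kx nox; rewrite /h' /h mem_set//; congr (_ - _).
  rewrite /s' big_map big_filter big_mkcond; apply: eq_big_seq => p /sL /LP[m [n pE]].
  case: ifPn => [p0|p0].
    have m0 : m%:~R = 0 :> R.
      by move: p0; rewrite pE mxE/= mulf_eq0 gt_eqF//= => /eqP.
    have -> : c' (p ord_max ord0) = kappa%:C%C * c p.
      congr (_ * c _); apply/colP => i; rewrite !mxE.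
      have [->|] := eqVneq i ord0; first by rewrite pE mxE/= m0 mulr0.
      case: (unliftP ord0 i) => [j ->|->]; last by rewrite eqxx.
      by rewrite (ord1 j) => _; congr (p _ _); apply: val_inj.
    rewrite -mulrA mulrCA; congr (_ * _); rewrite pE -/(e m n) eE.
    have -> : Kt m = K.
      by rewrite -Kt0; congr Kt; apply/eqP; rewrite -(intr_eq0 R) m0.
    rewrite indicE mem_set// mulr1 !mxE/=.
    by apply/eqP; rewrite eq_complex/= !mul0r !(subr0, addr0) !eqxx.
  rewrite pE -/(e m n) eE indicE memNset.
    by rewrite mulr0 !mul0r mulr0.
  move=> Kmx; apply: nox; exists (0, m); rewrite /= ?Kt0//.
  by apply: contra_neq p0; rewrite pE mxE/= => <-; rewrite mulr0.
(* The two errors agree almost everywhere on [K], and integrating over [K] gives at most the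
   integral over the line. *)
apply: le_lt_trans hlt; rewrite !L2normE; apply: ler_wsqrtr.
have [_ _ hI] := hL; have [_ _ h'I] := h'L.
have hIK : (leb R).-integrable K (fun x => (normC2 (h x))%:E) by exact: integrableS hI.
rewrite /Rintegral (ae_eq_integral (fun x => (normC2 (h x))%:E)) //; last 3 first.
- by case/integrableP: h'I.
- by case/integrableP: hIK.
- exists overlaps; split => //.
  by move=> x /= /not_implyP[Kx nx]; apply: contrapT => nox; apply: nx; rewrite hh'.
apply: fine_le; [exact: integrable_fin_num hIK | exact: integrable_fin_num hI |].
have /integrableP[mh _] := hI.
apply: (ge0_subset_integral (leb R) K_measurable measurableT mh) => // x _.
by rewrite lee_fin normC2_ge0.
Qed.
End lower_triangular_gabor.

(** * Reduction of rational lattices *)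

Section lattice.

(** Over a common denominator, [a] is the gcd of the numerators divided by that denominator. *)
Lemma rat_pair_bezout (p q : rat) : (p != 0) || (q != 0) ->
  exists a (P Q u v : int), [/\ 0 < a, p = a * P%:~R, q = a * Q%:~R &
    (u * P + v * Q = 1)%R].
Proof.
move=> pq0.
pose D := denq p * denq q; pose X := numq p * denq q; pose Y := numq q * denq p.
have D0 : 0 < D by rewrite mulr_gt0.
have DQ : D%:~R != 0 :> rat by rewrite intr_eq0 gt_eqF.
have dp : (denq p)%:~R != 0 :> rat by rewrite intr_eq0 denq_neq0.
have dq : (denq q)%:~R != 0 :> rat by rewrite intr_eq0 denq_neq0.
have pE : p = X%:~R / D%:~R.
  by rewrite /X /D !intrM -{1}(divq_num_den p); field; rewrite ?dp ?dq.
have qE : q = Y%:~R / D%:~R.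
  by rewrite /Y /D !intrM -{1}(divq_num_den q); field; rewrite ?dp ?dq.
have [u [v uv]] := Bezoutz X Y.
set g := gcdz X Y in uv.
have g0 : 0 < g.
  rewrite lt_neqAle eq_sym /g; apply/andP; split; last exact: le0z_nat.
  rewrite gcdz_eq0 /X /Y !mulf_eq0 !numq_eq0 !denq_eq0.
  by rewrite !orbF negb_and.
have /dvdzP[P XE] := dvdz_gcdl X Y; have /dvdzP[Q YE] := dvdz_gcdr X Y.
rewrite -/g in XE YE.
exists (g%:~R / D%:~R), P, Q, u, v; split.
- by rewrite divr_gt0// ltr0z.
- by rewrite pE XE intrM; field.
- by rewrite qE YE intrM; field.
- apply: (@mulIf _ g); first by rewrite gt_eqF.
  by rewrite mul1r -[RHS]uv XE YE; ring.
Qed.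

(** The first row of [M] is [a (P, Q)] with [u P + v Q = 1]. The integer coordinates [P z0 + Q z1]
    and [u z1 - v z0] come from a matrix of determinant 1 and make [M] lower triangular. Since the
    determinant of [M] is [eps = 1] or [-1], the second diagonal entry is [eps / a]; the sign is
    absorbed in [n]. *)
Lemma rational_lattice_lower_triangular (R : realType) (M : 'M[rat]_2) :
  M \in unitmx -> lattice_dens M = 1 ->
  exists a d : R, 0 < a /\ forall p : 'cV[R]_2, rational_lattice M p <->
    exists m n : int, p = \col_i (if i == ord0 then a * m%:~R
                                  else d * m%:~R + n%:~R / a).
Proof.
move=> Mu; rewrite /lattice_dens => dM.
pose i1 : 'I_2 := lift ord0 ord0.
have detE : \det M = M ord0 ord0 * M i1 i1 - M ord0 i1 * M i1 ord0.
  rewrite (expand_det_row _ ord0) !big_ord_recl big_ord0 addr0 -/i1.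
  rewrite /cofactor !det_mx11 !mxE/= expr0 mul1r expr1 mulN1r mulrN.
  by congr (_ * M _ _ - _ * M _ _); apply: val_inj.
have [] := @rat_pair_bezout (M ord0 ord0) (M ord0 i1).
  apply: contraTT Mu; rewrite negb_or !negbK => /andP[/eqP h1 /eqP h2].
  by rewrite detE h1 h2 !mul0r subrr.
move=> a [P [Q [u [v [a0 pE qE uv]]]]].
pose s := M i1 ord0; pose t := M i1 i1.
pose eps : int := if 0 <= \det M then 1 else -1.
have eps2 : eps * eps = 1 by rewrite /eps; case: ifP.
have detM : \det M = eps%:~R.
  move/eqP: dM; rewrite invr_eq1 => /eqP; rewrite /eps; case: ifPn => [d0|].
    by rewrite ger0_norm.
  by rewrite -ltNge => d0; rewrite ltr0_norm// intrN => h; rewrite -h opprK.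
have tE : - s * Q%:~R + t * P%:~R = eps%:~R / a.
  by rewrite -detM detE pE qE /s /t; field; rewrite gt_eqF.
have col0 (z : 'cV[int]_2) : (M *m map_mx intr z) ord0 ord0 =
    a * (P * z ord0 ord0 + Q * z i1 ord0)%:~R.
  rewrite mxE !big_ord_recl big_ord0 !mxE -/i1 pE qE addr0 intrD !intrM; ring.
have col1 (z : 'cV[int]_2) : (M *m map_mx intr z) i1 ord0 =
    (s * u%:~R + t * v%:~R) * (P * z ord0 ord0 + Q * z i1 ord0)%:~R
    + (eps * (u * z i1 ord0 - v * z ord0 ord0))%:~R / a.
  rewrite mxE !big_ord_recl big_ord0 !mxE -/i1 -/s -/t addr0.
  set x := z ord0 ord0; set y := z i1 ord0.
  rewrite intrM mulrAC -tE !(intrD, intrM, intrN).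
  have := congr1 (fun w : int => w%:~R : rat) uv; rewrite intrD !intrM => uv'.
  transitivity ((s * x%:~R + t * y%:~R) * (u%:~R * P%:~R + v%:~R * Q%:~R)).
    by rewrite uv' mulr1.
  by ring.
exists (ratr a), (ratr (s * u%:~R + t * v%:~R)); split; first by rewrite ltr0q.
have colP (z : 'cV[int]_2) : map_mx ratr (M *m map_mx intr z) =
    \col_i (if i == ord0 then ratr a * (P * z ord0 ord0 + Q * z i1 ord0)%:~R
      else ratr (s * u%:~R + t * v%:~R) * (P * z ord0 ord0 + Q * z i1 ord0)%:~R
         + (eps * (u * z i1 ord0 - v * z ord0 ord0))%:~R / ratr a) :> 'cV[R]_2.
  apply/colP => i; rewrite [LHS]mxE [RHS]mxE.
  have [->|] := eqVneq i ord0; first by rewrite col0 rmorphM/= ratr_int.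
  case: (unliftP ord0 i) => [j ->|->]; last by rewrite eqxx.
  rewrite (ord1 j) -/i1 => _.
  by rewrite col1 rmorphD/= rmorphM/= fmorph_div/= !ratr_int.
move=> p; split=> [[z _ <-]|[m [n ->]]].
  by rewrite colP; do 2 eexists; reflexivity.
(* The inverse change of coordinates, applied to [(m, eps n)]. *)
pose z : 'cV[int]_2 := \col_i (if i == ord0 then u * m - Q * (eps * n)
                               else v * m + P * (eps * n)).
exists z => //; rewrite colP.
have -> : P * z ord0 ord0 + Q * z i1 ord0 = m.
  by rewrite !mxE/=; transitivity ((u * P + v * Q) * m); [ring | rewrite uv mul1r].
have -> // : eps * (u * z i1 ord0 - v * z ord0 ord0) = n.
rewrite !mxE/=; transitivity ((eps * eps) * ((u * P + v * Q) * n)); first ring.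
by rewrite eps2 uv !mul1r.
Qed.
End lattice.

Theorem theorem1p5 (R : realType) (K : set R) (M : 'M[rat]_2)
  (K_bounded : bounded_set K)
  (K_measurable : measurable (K : set (lebesgueType R)))
  (K_pos : (0 < leb R K)%E)
  (M_inv : M \in unitmx)
  (M_dens : lattice_dens M = 1)
  (K_gabor : gabor_orthonormal_basis (normalized_indicator K)
               (rational_lattice M)) :
  tiles K /\ spectral K.
Proof.
have [a [d [a0 LP]]] := rational_lattice_lower_triangular R M_inv M_dens.
split; first exact: gabor_tiles K_bounded K_measurable K_pos a0 LP K_gabor.
exact: gabor_spectral K_bounded K_measurable K_pos a0 LP K_gabor.
Qed.
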